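(* Let $A=K^m$ and let $\Gamma$ be a quiver of reduced rank one without cycles of length two. A splitted, unital and factorizable representation of $\Gamma$ over $A$ is uniquely defined by a set of idempotent functions $u_i:\{1,\ldots,m\}\to\{1,\ldots,m\}$, with $i\in\Gamma^0$, satisfying the following condition: if $\alpha\in\Gamma^1$ is not a loop and $p\in\{1,\ldots,m\}$, then $u_{s(\alpha)}(p)=p$ or $u_{t(\alpha)}(p)=p$.
   Context: $K$ is a field; $K^m$ is the product algebra with canonical basis $\{f_1,\ldots,f_m\}$. A quiver $\Gamma$ has a vertex set $\Gamma^0$, an arrow set $\Gamma^1$, and source and target maps $s,t$. $\Gamma^1(i,j)$ is the set of arrows from $i$ to $j$; $\Gamma^2(i,j)$ is the set of pairs $(\alpha_1,\alpha_2)$ of arrows with $s(\alpha_1)=i$, $t(\alpha_1)=s(\alpha_2)$, $t(\alpha_2)=j$. Throughout, $\Gamma$ is finite, has no multiple arrows ($\#\Gamma^1(i,j)\le 1$ for all $i,j$), and every vertex carries a (unique) loop. A cycle of length two consists of two distinct vertices $i\neq j$ with an arrow $i\to j$ and an arrow $j\to i$. $\mathrm{rrank}(i)=\#\{\alpha\in\Gamma^1\mid t(\alpha)=i,\ s(\alpha)\neq i\}$, and the reduced rank of $\Gamma$ is $\max_i\mathrm{rrank}(i)$. A function $u$ is idempotent if $u\circ u=u$. A representation of $\Gamma$ over $A$ is a representation with the vector space $A$ at every vertex, i.e. a family $(\varphi_\alpha)_{\alpha\in\Gamma^1}$ of $K$-linear maps $A\to A$. It is: splitted if for every vertex $i$ and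 all arrows $\alpha',\alpha''$ with target $i$, $\varphi_{\alpha'}\circ\varphi_{\alpha''}=\delta_{s(\alpha'),s(\alpha'')}\varphi_{\alpha'}$, and $\sum_{t(\alpha)=i}\varphi_\alpha=\mathrm{Id}_A$; unital if $\varphi_\alpha(1_A)=\delta_{s(\alpha),t(\alpha)}1_A$ for every arrow $\alpha$; factorizable if for all vertices $i,j$ and $a,b\in A$, $\sum_{(\alpha_1,\alpha_2)\in\Gamma^2(i,j)}\varphi_{\alpha_1}(a)\varphi_{\alpha_2}(b)$ equals $\varphi_\alpha(ab)$ if $\Gamma^1(i,j)=\{\alpha\}$, and $0$ if $\Gamma^1(i,j)=\emptyset$. The map $\varphi_i$ attached to the loop at $i$ and the function $u_i$ are related by $\varphi_i(f_p)=\sum_{q=1}^m\delta_{p,u_i(q)}f_q$ for $p=1,\dots,m$.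
   Formalization: A set of functions u_i as described comes from a representation exactly when also u_i is the identity at each vertex i with rrank(i)=0; without this the correspondence fails (e.g. one non-loop arrow 0→1, u_1 the identity, u_0 not). *)

(* Defs.v *)
From mathcomp Require Import all_boot all_algebra.
Set Implicit Arguments.
Unset Strict Implicit.
Unset Printing Implicit Defensive.
Import GRing.Theory.
Local Open Scope ring_scope.

Record quiver : Type := Quiver {
  vertex : finType;
  arrow : finType;
  src : arrow -> vertex;
  tgt : arrow -> vertex
}.
Arguments src {_} _.
Arguments tgt {_} _.

Definition arrows (G : quiver) (i j : vertex G) : {set arrow G} :=
  [set a | (src a == i) && (tgt a == j)].

Definition paths2 (G : quiver) (i j : vertex G) : {set arrow G * arrow G} :=
  [set ab | [&& src ab.1 == i, tgt ab.1 == src ab.2 & tgt ab.2 == j]].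

Definition no_multiple_arrows (G : quiver) : Prop :=
  forall i j : vertex G, (#|arrows i j| <= 1)%N.

Definition every_vertex_has_loop (G : quiver) : Prop :=
  forall i : vertex G, exists a : arrow G, a \in arrows i i.

Definition has_cycle_of_length_two (G : quiver) : Prop :=
  exists i j : vertex G, [/\ i != j, arrows i j != set0 & arrows j i != set0].

Definition rrank (G : quiver) (i : vertex G) : nat :=
  #|[set a : arrow G | (tgt a == i) && (src a != i)]|.

Definition reduced_rank (G : quiver) : nat :=
  (\max_(i : vertex G) rrank i)%N.

(* K^m is the pointwise algebra {ffun 'I_m -> K}. Writing K^o makes the same
   carrier a vector space over K, as required by the type 'End of its K-linear
   endomorphisms. *)
Notation Kpow K m := {ffun 'I_m -> K^o}.

Definition fbasis (K : fieldType) (m : nat) (p : 'I_m) : Kpow K m :=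
  [ffun q => (q == p)%:R].

Definition representation (K : fieldType) (m : nat) (G : quiver) : Type :=
  {ffun arrow G -> 'End(Kpow K m)}.

Definition splitted (K : fieldType) (m : nat) (G : quiver)
    (phi : representation K m G) : Prop :=
  forall i : vertex G,
    (forall a a' : arrow G, tgt a = i -> tgt a' = i ->
       (phi a \o phi a')%VF = if src a == src a' then phi a else 0) /\
    \sum_(a : arrow G | tgt a == i) phi a = \1%VF.

Definition unital (K : fieldType) (m : nat) (G : quiver)
    (phi : representation K m G) : Prop :=
  forall a : arrow G, phi a 1 = if src a == tgt a then 1 else 0.

Definition factorizable (K : fieldType) (m : nat) (G : quiver)
    (phi : representation K m G) : Prop :=
  forall (i j : vertex G) (x y : Kpow K m),
    (forall a : arrow G, arrows i j = [set a] ->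
       \sum_(ab in paths2 i j) phi ab.1 x * phi ab.2 y = phi a (x * y)) /\
    (arrows i j = set0 ->
       \sum_(ab in paths2 i j) phi ab.1 x * phi ab.2 y = 0).

Definition vertex_functions (m : nat) (G : quiver) : Type :=
  {ffun vertex G -> {ffun 'I_m -> 'I_m}}.

Definition idempotent_functions (m : nat) (G : quiver)
    (u : vertex_functions m G) : Prop :=
  forall (i : vertex G) (p : 'I_m), u i (u i p) = u i p.

Definition arrow_condition (m : nat) (G : quiver)
    (u : vertex_functions m G) : Prop :=
  forall (a : arrow G) (p : 'I_m), src a != tgt a ->
    u (src a) p = p \/ u (tgt a) p = p.

Definition loops_given_by (K : fieldType) (m : nat) (G : quiver)
    (phi : representation K m G) (u : vertex_functions m G) : Prop :=
  forall (i : vertex G) (l : arrow G), l \in arrows i i ->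
    forall p : 'I_m,
      phi l (fbasis K p) = \sum_(q < m) (p == u i q)%:R *: fbasis K q.

(* Main.v *)
(** Over a target vertex [i] there are only the loop and at most one other
    arrow, so splitting forces the other arrow to carry [Id - phi_i], and
    [phi_i = Id] if there is none.  The only path of length two from [i] to
    itself is the doubled loop, so [phi_i] is a unital algebra endomorphism of
    [K^m], i.e. [x |-> x \o u_i].  For an arrow [i -> j] the only paths of
    length two from [i] to [j] use a loop, and factorizability becomes
    [(x (u_i q) - x q) * (y q - y (u_j q)) = 0] for all [x], [y], [q], which is
    the arrow condition. *)
Require Import Defs.
From HB Require Import structures.
From mathcomp Require Import all_boot all_algebra.
From mathcomp Require Import ring.
Set Implicit Arguments.
Unset Strict Implicit.
Unset Printing Implicit Defensive.
Import GRing.Theory.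
Local Open Scope ring_scope.

(** * Arrows and paths of length two in a quiver of reduced rank one *)

Section Quiver.
Variable G : quiver.
Hypothesis G_simple : no_multiple_arrows G.
Hypothesis G_rank1 : reduced_rank G = 1%N.
Hypothesis G_no2 : ~ has_cycle_of_length_two G.
Implicit Types (i j : vertex G) (a b l : arrow G).

Lemma arrow_inj a b : src a = src b -> tgt a = tgt b -> a = b.
Proof.
move=> sab tab; have /card_le1_eqP := G_simple (src a) (tgt a).
by apply; rewrite inE ?sab ?tab !eqxx.
Qed.

Lemma in_arrows i j a : (a \in arrows i j) = (src a == i) && (tgt a == j).
Proof. by rewrite inE. Qed.

Lemma arrows_eq1 a : arrows (src a) (tgt a) = [set a].
Proof.
apply/setP => b; rewrite in_arrows in_set1.
by apply/andP/eqP => [[/eqP sb /eqP tb]|->//]; apply: arrow_inj.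
Qed.

Lemma nonloop_inj a b :
  src a != tgt a -> src b != tgt b -> tgt a = tgt b -> a = b.
Proof.
move=> na nb tab; have : (rrank (tgt a) <= 1)%N.
  by rewrite -G_rank1; apply: (leq_bigmax (F := @rrank G)).
by move/card_le1_eqP; apply; rewrite inE ?tab eqxx -?tab //= tab.
Qed.

Lemma opposite_arrows_loop a b :
  src a = tgt b -> tgt a = src b -> src a = tgt a.
Proof.
move=> sa ta; apply/eqP/negP => /negP na; case: G_no2.
exists (src a), (tgt a); split=> //; apply/set0Pn.
  by exists a; rewrite in_arrows !eqxx.
by exists b; rewrite in_arrows sa ta !eqxx.
Qed.

(** A path that leaves [i] for another vertex and returns would be a cycle of length two, so both of
    its arrows are loops at [i]. *)
Lemma paths2_loop i l : l \in arrows i i -> paths2 i i = [set (l, l)].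
Proof.
rewrite in_arrows => /andP[/eqP sl /eqP tl]; apply/setP => -[a b].
rewrite in_set1 inE /=; apply/and3P/eqP => [[/eqP sa /eqP ab /eqP tb]|[-> ->]].
  have aL : src a = tgt a by apply: (opposite_arrows_loop (b := b)); rewrite ?sa.
  by congr pair; apply: arrow_inj; rewrite ?sl ?tl -?ab -?aL.
by rewrite sl tl.
Qed.

Lemma paths2_nonloop a li lj : src a != tgt a ->
  li \in arrows (src a) (src a) -> lj \in arrows (tgt a) (tgt a) ->
  paths2 (src a) (tgt a) = [set (li, a); (a, lj)].
Proof.
rewrite !in_arrows => na /andP[/eqP si /eqP ti] /andP[/eqP sj /eqP tj].
apply/setP => -[b c]; rewrite in_set2 inE /= !xpair_eqE.
apply/and3P/orP => [[/eqP sb /eqP bc /eqP tc]|].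
  (* If the second arrow is a loop, the first is parallel to [a]. Otherwise rank one identifies the
     second with [a], and the first is the loop at its source. *)
  have [cL|nc] := eqVneq (src c) (tgt c).
    right; apply/andP; split; apply/eqP; apply: arrow_inj; congruence.
  have ca := nonloop_inj nc na tc.
  left; apply/andP; split; apply/eqP; apply: arrow_inj; congruence.
by case=> /andP[/eqP-> /eqP->]; rewrite ?si ?ti ?sj ?tj !eqxx.
Qed.

Lemma sum_tgt_loop (V : nmodType) (F : arrow G -> V) i l : l \in arrows i i ->
  \sum_(a | tgt a == i) F a = F l + \sum_(a | (tgt a == i) && (src a != i)) F a.
Proof.
rewrite in_arrows => /andP[/eqP sl /eqP tl].
rewrite (bigD1 l) ?tl //=; congr (_ + _); apply: eq_bigl => a.
have [ta|//] /= := eqVneq (tgt a) i; congr negb.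
by apply/eqP/eqP => [->//|sa]; apply: arrow_inj; congruence.
Qed.

Lemma sum_tgt_nonloop (V : nmodType) (F : arrow G -> V) a l :
    src a != tgt a -> l \in arrows (tgt a) (tgt a) ->
  \sum_(b | tgt b == tgt a) F b = F l + F a.
Proof.
move=> na lP; rewrite (sum_tgt_loop _ lP); congr (_ + _).
rewrite (big_pred1 a) // => b /=; apply/andP/eqP => [[/eqP tb nb]|->]; last first.
  by rewrite eqxx.
by apply: nonloop_inj => //; rewrite tb.
Qed.

Lemma sum_tgt_rrank0 (V : nmodType) (F : arrow G -> V) i l :
    l \in arrows i i -> rrank i = 0%N ->
  \sum_(b | tgt b == i) F b = F l.
Proof.
move=> lP /eqP; rewrite /rrank cards_eq0 => /eqP r0.
rewrite (sum_tgt_loop _ lP) big_pred0 ?addr0 // => b.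
by have := in_set0 b; rewrite -r0 inE.
Qed.

End Quiver.

(** * Unital algebra endomorphisms of $K^m$ in coordinates *)

Section Coordinates.
Variables (K : fieldType) (m : nat).
Implicit Types (x y : Kpow K m) (p q : 'I_m).

Lemma fbasis_expand x : x = \sum_p x p *: fbasis K p.
Proof.
apply/ffunP => q; rewrite sum_ffunE (bigD1 q) //= big1 => [|p npq].
  by rewrite !ffunE eqxx addr0 [_ *: _]mulr1.
by rewrite !ffunE eq_sym (negbTE npq) scaler0.
Qed.

Lemma fbasis_mul p p' :
  fbasis K p * fbasis K p' = if p == p' then fbasis K p else 0.
Proof.
apply/ffunP => q; rewrite !ffunE.
have [<-|npp'] := eqVneq p p'; rewrite ?ffunE.
  by case: (q == p); rewrite ?mulr1 ?mul0r.
have [->|_] := eqVneq q p; last by rewrite mul0r.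
by rewrite (negbTE npp') mulr0.
Qed.

(** The images of the [fbasis K p] are orthogonal idempotents with sum 1, so at each coordinate
    exactly one of them is nonzero, and its value there is 1. *)
Lemma algebra_endomorphismP (f : 'End(Kpow K m)) :
    f 1 = 1 -> (forall x y, f x * f y = f (x * y)) ->
  exists w : {ffun 'I_m -> 'I_m}, forall p q, f (fbasis K p) q = (p == w q)%:R.
Proof.
move=> f1 fM.
have fMq x y q : f x q * f y q = f (x * y) q by rewrite -fM ffunE.
(* If all images vanished at [q], then so would [f 1], because 1 is a combination of the basis
   vectors. *)
have /fin_all_exists[w wP] q : exists p, f (fbasis K p) q != 0.
  apply/existsP; apply: contraT; rewrite negb_exists => /forallP f0.
  have /ffunP/(_ q) := f1; rewrite {1}[1]fbasis_expand linear_sum sum_ffunE.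
  rewrite big1 => [|p _]; last first.
    by rewrite linearZ ffunE; move: (f0 p); rewrite negbK => /eqP->; rewrite scaler0.
  by rewrite ffunE => /esym/eqP; rewrite oner_eq0.
(* Multiplying by the nonzero value of [f (fbasis K (w q))] at [q] reduces the claim to
   orthogonality of the basis. *)
exists (finfun w) => p q; rewrite ffunE; apply: (mulIf (wP q)).
rewrite fMq fbasis_mul; case: eqP => [->|_]; first by rewrite mul1r.
by rewrite linear0 ffunE mul0r.
Qed.

Lemma fbasis_sumE (w : {ffun 'I_m -> 'I_m}) p q :
  (\sum_(r < m) (p == w r)%:R *: fbasis K r) q = (p == w q)%:R.
Proof.
rewrite -[RHS](ffunE (fun r => (p == w r)%:R : K^o) q).
congr (fun_of_fin _ q); rewrite [RHS]fbasis_expand.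
by apply: eq_bigr => r _; rewrite ffunE.
Qed.

Lemma delta_eq1 p q : (q == p)%:R = 1 :> K -> q = p.
Proof.
by case: eqP => // _ /esym/eqP; rewrite oner_eq0.
Qed.

Definition pullback (w : {ffun 'I_m -> 'I_m}) (x : Kpow K m) : Kpow K m :=
  [ffun q => x (w q)].

Lemma pullback_is_linear w : linear (pullback w).
Proof. by move=> k x y; apply/ffunP => q; rewrite !ffunE. Qed.
HB.instance Definition _ w :=
  GRing.isLinear.Build K (Kpow K m) (Kpow K m) *:%R (pullback w)
    (pullback_is_linear w).

End Coordinates.

(** * Representations described by vertex functions *)

Section Representations.
Variables (K : fieldType) (m : nat) (G : quiver).
Hypothesis G_simple : no_multiple_arrows G.
Hypothesis G_loops : every_vertex_has_loop G.
Hypothesis G_rank1 : reduced_rank G = 1%N.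
Hypothesis G_no2 : ~ has_cycle_of_length_two G.
Implicit Types (phi psi : representation K m G) (u : vertex_functions m G).

(** The coordinate form of the whole representation, non-loop arrows included; each of the three
    conditions on [phi] is tested in this form. *)
Definition pulls_back phi u : Prop :=
  forall (a : arrow G) (x : Kpow K m) (q : 'I_m),
    phi a x q = if src a == tgt a then x (u (tgt a) q)
                else x q - x (u (tgt a) q).

Lemma loop_pulls_back phi u l i x q :
  pulls_back phi u -> l \in arrows i i -> phi l x q = x (u i q).
Proof.
by move=> phiu; rewrite in_arrows phiu => /andP[/eqP-> /eqP->]; rewrite eqxx.
Qed.

Lemma pulls_back_loops_given_by phi u : pulls_back phi u -> loops_given_by phi u.
Proof.
move=> phiu i l lP p; apply/ffunP => q.
by rewrite (loop_pulls_back _ _ phiu lP) fbasis_sumE ffunE eq_sym.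
Qed.

(** Linearity extends the formula for a loop from the basis to all vectors; the sum condition at the
    target then determines the remaining arrow. *)
Lemma splitted_pulls_back phi u :
  splitted phi -> loops_given_by phi u -> pulls_back phi u.
Proof.
move=> phiS phiu.
have loopE i l x q : l \in arrows i i -> phi l x q = x (u i q).
  move=> lP; rewrite [x in LHS]fbasis_expand linear_sum sum_ffunE.
  rewrite (bigD1 (u i q)) //= big1 => [|p np].
    by rewrite addr0 linearZ /= ffunE (phiu i) // fbasis_sumE eqxx [_ *: _]mulr1.
  by rewrite linearZ /= ffunE (phiu i) // fbasis_sumE (negbTE np) scaler0.
move=> a x q; have [aL|na] := eqVneq (src a) (tgt a).
  by apply: loopE; rewrite in_arrows aL !eqxx.
have [l lP] := G_loops (tgt a); have [_] := phiS (tgt a).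
rewrite (sum_tgt_nonloop G_simple G_rank1 _ na lP) => /lfunP/(_ x).
rewrite add_lfunE id_lfunE => /ffunP/(_ q); rewrite ffunE (loopE _ _ _ _ lP).
by move=> <-; rewrite addrAC subrr add0r.
Qed.

Lemma pulls_back_unital phi u : pulls_back phi u -> unital phi.
Proof.
move=> phiu a; apply/ffunP => q; rewrite phiu !ffunE.
by case: eqP; rewrite ffunE ?subrr.
Qed.

Lemma pulls_back_splitted phi u : pulls_back phi u ->
  splitted phi <->
  idempotent_functions u /\
  (forall i, rrank i = 0%N -> forall p, u i p = p).
Proof.
move=> phiu; split=> [phiS|[uI u0] i].
  split=> i.
    move=> p; have [l lP] := G_loops i; have [phiM _] := phiS i.
    have tl : tgt l = i by move: lP; rewrite in_arrows => /andP[_ /eqP].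
    (* Evaluating the idempotence of the loop map on [fbasis K (u i p)] at coordinate [p] compares
       [u i (u i p)] with [u i p]. *)
    have := phiM l l tl tl; rewrite eqxx => /lfunP/(_ (fbasis K (u i p))).
    rewrite comp_lfunE => /ffunP/(_ p).
    by rewrite !(loop_pulls_back _ _ phiu lP) !ffunE eqxx => /delta_eq1.
  move=> r0 p; have [l lP] := G_loops i; have [_] := phiS i.
  rewrite (sum_tgt_rrank0 G_simple _ lP r0) => /lfunP/(_ (fbasis K p)).
  rewrite id_lfunE => /ffunP/(_ p).
  by rewrite (loop_pulls_back _ _ phiu lP) !ffunE eqxx => /delta_eq1.
split=> [a b ta tb|].
  apply/lfunP => x; apply/ffunP => q; rewrite comp_lfunE.
  have [sab|nsab] := eqVneq (src a) (src b).
    have <- : a = b by apply: arrow_inj => //; rewrite ta.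
    rewrite !phiu; case: eqP => _; first by rewrite uI.
    by rewrite uI subrr subr0.
  rewrite lfunE /= ffunE !phiu ta tb.
  (* Two distinct arrows into [i] are the loop and the non-loop, and the composite vanishes in
     either order because [u i] is idempotent. *)
  have [sa|na] := eqVneq (src a) i; have [sb|nb] := eqVneq (src b) i.
  - by case/eqP: nsab; rewrite sa.
  - by rewrite uI subrr.
  - by rewrite uI subrr.
  - by case/eqP: nsab; congr src; apply: nonloop_inj; rewrite ?ta ?tb.
have [l lP] := G_loops i.
have [r0|] := eqVneq (rrank i) 0%N.
  rewrite (sum_tgt_rrank0 G_simple _ lP r0); apply/lfunP => x.
  by apply/ffunP => q; rewrite id_lfunE (loop_pulls_back _ _ phiu lP) u0.
rewrite /rrank cards_eq0 => /set0Pn[a]; rewrite inE => /andP[/eqP ta na].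
subst i; rewrite (sum_tgt_nonloop G_simple G_rank1 _ na lP); apply/lfunP => x.
apply/ffunP => q; rewrite add_lfunE id_lfunE ffunE (loop_pulls_back _ _ phiu lP).
by rewrite phiu (negbTE na) addrC subrK.
Qed.

(** The product added to [phi a (x * y) q] is the defect of factorizability along [a]. It comes from
    expanding the two paths through the loops at the ends of [a]. *)
Lemma nonloop_factorizationE phi u (a : arrow G) (x y : Kpow K m) (q : 'I_m) :
    pulls_back phi u -> src a != tgt a ->
  (\sum_(bc in paths2 (src a) (tgt a)) phi bc.1 x * phi bc.2 y) q =
  phi a (x * y) q + (x (u (src a) q) - x q) * (y q - y (u (tgt a) q)).
Proof.
move=> phiu na; have [li liP] := G_loops (src a).
have [lj ljP] := G_loops (tgt a).
rewrite (paths2_nonloop G_simple G_rank1 na liP ljP) big_setU1 /=; last first.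
  rewrite in_set1 xpair_eqE negb_and; apply/orP; left.
  apply: contraNneq na => li_a; move: liP.
  by rewrite in_arrows li_a => /andP[_ /eqP->].
rewrite big_set1 /= !ffunE (loop_pulls_back _ _ phiu liP).
rewrite (loop_pulls_back _ _ phiu ljP) !phiu (negbTE na) !ffunE.
set X := x q; set Y := y q; set X1 := x _; set X2 := x _; set Y2 := y _.
by ring.
Qed.

Lemma pulls_back_factorizable phi u :
  pulls_back phi u -> factorizable phi <-> arrow_condition u.
Proof.
move=> phiu; split=> [phiF a p na|uC i j x y].
  have [->|np] := eqVneq (u (src a) p) p; [by left | right].
  (* With both arguments equal to [fbasis K p], the defect at [p] has first factor -1 once
     [u (src a)] moves [p], so the second factor must vanish. *)
  have := phiF (src a) (tgt a) (fbasis K p) (fbasis K p).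
  case=> /(_ a (arrows_eq1 G_simple a))/ffunP/(_ p) + _.
  rewrite (nonloop_factorizationE _ _ _ phiu na) => /eqP.
  rewrite -subr_eq0 addrAC subrr add0r !ffunE eqxx (negbTE np).
  rewrite sub0r mulN1r oppr_eq0 subr_eq0 => /eqP/esym.
  exact: delta_eq1.
split=> [a aE|a0].
  have : a \in arrows i j by rewrite aE in_set1.
  rewrite in_arrows => /andP[/eqP ? /eqP ?]; subst i j; apply/ffunP => q.
  have [aL|na] := eqVneq (src a) (tgt a).
    have aP : a \in arrows (src a) (src a) by rewrite in_arrows -aL eqxx.
    rewrite -aL (paths2_loop G_simple G_no2 aP) big_set1 /= ffunE.
    by rewrite !(loop_pulls_back _ _ phiu aP) ffunE.
  rewrite (nonloop_factorizationE _ _ _ phiu na).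
  by case: (uC a q na) => ->; rewrite subrr ?mul0r ?mulr0 addr0.
(* With no arrow from [i] to [j], neither arrow of a path can be a loop, since the other one would
   join [i] to [j]. The arrow condition for [b] at [q] then kills one of the two differences. *)
rewrite big1 // => -[a b]; rewrite inE /= => /and3P[/eqP sa /eqP ab /eqP tb].
have na : src a != tgt a.
  apply/eqP => aL; have := in_set0 b.
  by rewrite -a0 in_arrows tb -ab -aL sa !eqxx.
have nb : src b != tgt b.
  apply/eqP => bL; have := in_set0 a.
  by rewrite -a0 in_arrows sa ab bL tb !eqxx.
apply/ffunP => q; rewrite !ffunE !phiu (negbTE na) (negbTE nb) ab.
by case: (uC b q nb) => ->; rewrite subrr ?mul0r ?mulr0.
Qed.

Lemma pulls_back_exists u : exists phi, pulls_back phi u.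
Proof.
exists [ffun a : arrow G =>
  let f := linfun (pullback (K := K) (u (tgt a))) in
  if src a == tgt a then f else (\1 - f)%VF].
move=> a x q; rewrite ffunE /=; case: eqP => _; first by rewrite lfunE /= ffunE.
by rewrite add_lfunE opp_lfunE id_lfunE lfunE /= !ffunE.
Qed.

Lemma pulls_back_inj phi psi u : pulls_back phi u -> pulls_back psi u -> phi = psi.
Proof.
move=> phiu psiu; apply/ffunP => a; apply/lfunP => x; apply/ffunP => q.
by rewrite phiu psiu.
Qed.

(** Since the doubled loop is the only path of length two from a vertex to itself, factorizability
    says that the loop map is multiplicative. *)
Lemma loops_given_by_exists phi : unital phi -> factorizable phi ->
  exists u, loops_given_by phi u.
Proof.
move=> phi1 phiF.
have /fin_all_exists[w wP] i : exists w : {ffun 'I_m -> 'I_m},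
    forall l, l \in arrows i i ->
    forall p q, phi l (fbasis K p) q = (p == w q)%:R.
  have [l lP] := G_loops i.
  have [sl tl] : src l = i /\ tgt l = i.
    by move: lP; rewrite in_arrows => /andP[/eqP-> /eqP->].
  have lE : arrows i i = [set l] by rewrite -{1}sl -tl arrows_eq1.
  have [||w wP] := @algebra_endomorphismP K m (phi l).
  - by rewrite phi1 sl tl eqxx.
  - move=> x y; have [/(_ l lE) <- _] := phiF i i x y.
    by rewrite (paths2_loop G_simple G_no2 lP) big_set1.
  by exists w => b; rewrite lE in_set1 => /eqP->.
exists (finfun w) => i l lP p; apply/ffunP => q.
by rewrite (wP i) // fbasis_sumE ffunE.
Qed.

Lemma loops_given_by_inj phi u v :
  loops_given_by phi u -> loops_given_by phi v -> u = v.
Proof.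
move=> phiu phiv; apply/ffunP => i; apply/ffunP => q.
(* The image of [fbasis K (u i q)] has coordinate 1 at [q], which forces [v i q] to be the same
   index. *)
have [l lP] := G_loops i; have := phiu i l lP (u i q).
rewrite (phiv i l lP) => /ffunP/(_ q); rewrite !fbasis_sumE eqxx.
exact: delta_eq1.
Qed.

End Representations.

(** Splitting makes [u i] the identity wherever only the loop arrives, so idempotence and the arrow
    condition alone need not yield a representation; the last clause therefore singles out the
    families that do. *)
Theorem theorem2p13 (K : fieldType) (m : nat) (G : quiver)
    (G_simple : no_multiple_arrows G)
    (G_loops : every_vertex_has_loop G)
    (G_rank1 : reduced_rank G = 1%N)
    (G_no2 : ~ has_cycle_of_length_two G) :
  [/\ (forall phi : representation K m G,
         splitted phi -> unital phi -> factorizable phi ->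
         exists u : vertex_functions m G,
           [/\ unique (loops_given_by phi) u,
               idempotent_functions u & arrow_condition u]),
      (forall (phi psi : representation K m G) (u : vertex_functions m G),
         splitted phi -> unital phi -> factorizable phi ->
         splitted psi -> unital psi -> factorizable psi ->
         loops_given_by phi u -> loops_given_by psi u -> phi = psi) &
      (forall u : vertex_functions m G,
         idempotent_functions u -> arrow_condition u ->
         (exists phi : representation K m G,
            [/\ splitted phi, unital phi, factorizable phi &
                loops_given_by phi u]) <->
         (forall i : vertex G, rrank i = 0%N ->
            forall p : 'I_m, u i p = p))].
Proof.
split=> [phi phiS phi1 phiF|phi psi u phiS _ _ psiS _ _ phiu psiu|u uI uC].
- have [u phiu] := loops_given_by_exists G_simple G_loops G_no2 phi1 phiF.
  have phipb := splitted_pulls_back G_simple G_loops G_rank1 phiS phiu.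
  exists u; split.
  + by split=> // v; apply: loops_given_by_inj.
  + by have [/(_ phiS)[]] :=
      pulls_back_splitted G_simple G_loops G_rank1 phipb.
  + by apply/(pulls_back_factorizable G_simple G_loops G_rank1 G_no2 phipb).
- by apply: (@pulls_back_inj _ _ _ _ _ u); apply: splitted_pulls_back.
- split=> [[phi [phiS _ _ phiu]]|u0].
    have phipb := splitted_pulls_back G_simple G_loops G_rank1 phiS phiu.
    by have [/(_ phiS)[]] :=
      pulls_back_splitted G_simple G_loops G_rank1 phipb.
  have [phi phipb] := pulls_back_exists K u.
  exists phi; split.
  + by apply/(pulls_back_splitted G_simple G_loops G_rank1 phipb).
  + exact: pulls_back_unital phipb.
  + by apply/(pulls_back_factorizable G_simple G_loops G_rank1 G_no2 phipb).
  + exact: pulls_back_loops_given_by.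
Qed.
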